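(* Let $n\ge 2$ be an integer and let $M=\{(x,f(x)) : x\in\mathbb R^n\}\subset\mathbb R^{n+1}$ be an entire graph, i.e. the graph of a $C^2$ function $f:\mathbb R^n\to\mathbb R$. If the mean curvature $H$ of $M$ is bounded, then the (normalized) scalar curvature $R$ of $M$ satisfies $$\inf_M|R|=0 .$$ In particular, if (in addition) the scalar curvature $R$ is constant, then $R=0$.
   Context: The graph $M$ is oriented by a choice of continuous unit normal field. Let $A$ denote the shape operator of $M$ and $k_1(p)\le\dots\le k_n(p)$ the principal curvatures (eigenvalues of $A$) at $p\in M$. The mean curvature is $H=\frac1n\sum_{i=1}^n k_i$. The scalar curvature is normalized and given by the Gauss equation as $R=\frac{2}{n(n-1)}\sum_{1\le i<j\le n}k_ik_j$. *)

(* Defs.v *)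
From mathcomp Require Import all_boot all_order all_algebra.
From mathcomp Require Import all_classical all_reals all_analysis.

Set Implicit Arguments.
Unset Strict Implicit.
Unset Printing Implicit Defensive.

Import Order.TTheory GRing.Theory Num.Theory.
Import numFieldNormedType.Exports.

Local Open Scope classical_set_scope.
Local Open Scope ring_scope.

(* Class C^1 in the Frechet sense. Since the domain has finite dimension,       *)
(* continuity of the differential is tested on fixed vectors.                   *)
Definition is_C1 (R : realType) (n : nat) (f : 'rV[R]_n -> R) : Prop :=
  (forall x, differentiable f x) /\ (forall v, continuous ('D_v f)).

Definition is_C2 (R : realType) (n : nat) (f : 'rV[R]_n -> R) : Prop :=
  is_C1 f /\ (forall v, is_C1 ('D_v f)).

(* R^(n+1) is 'rV[R]_(n + 1), its last coordinate being the vertical one.       *)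
Definition graph_param (R : realType) (n : nat) (f : 'rV[R]_n -> R)
    (x : 'rV[R]_n) : 'rV[R]_(n + 1) :=
  row_mx x (f x)%:M.

Definition graph (R : realType) (n : nat) (f : 'rV[R]_n -> R) :
    set 'rV[R]_(n + 1) :=
  range (graph_param f).

(* The rows are the coordinate vector fields (e_i, 'D_(e_i) f), which form a    *)
(* basis of the tangent space of the graph.                                     *)
Definition tangent_basis (R : realType) (n : nat) (f : 'rV[R]_n -> R)
    (p : 'rV[R]_(n + 1)) : 'M[R]_(n, n + 1) :=
  'J (graph_param f) (lsubmx p).

(* Both choices of orientation (upward and downward) are allowed.               *)
Definition unit_normal_field (R : realType) (n : nat) (f : 'rV[R]_n -> R)
    (N : 'rV[R]_(n + 1) -> 'rV[R]_(n + 1)) : Prop :=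
  {within graph f, continuous N} /\
  (forall p, graph f p ->
     N p *m (N p)^T = 1%:M /\ tangent_basis f p *m (N p)^T = 0).

(* Matrix of the shape operator v |-> - dN_p(v) of the tangent space at p, in   *)
(* the basis given by the rows X_i of [tangent_basis f p]. It acts on the right *)
(* of row vectors: [pinvmx] returns the coefficients on the X_i, so that        *)
(*   - dN_p(X_i) = \sum_j shape_mx f N p i j *: X_j.                            *)
(* The derivative of N along X_i is the i-th partial derivative of N read in    *)
(* the global parametrization; N need not be smooth off the graph.              *)
Definition shape_mx (R : realType) (n : nat) (f : 'rV[R]_n -> R)
    (N : 'rV[R]_(n + 1) -> 'rV[R]_(n + 1)) (p : 'rV[R]_(n + 1)) : 'M[R]_n :=
  - 'J (N \o graph_param f) (lsubmx p) *m pinvmx (tangent_basis f p).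

(* The eigenvalues of the shape operator in nondecreasing order, repeated       *)
(* according to multiplicity. As the shape operator is self-adjoint for the     *)
(* induced metric, its characteristic polynomial splits over R, so that the     *)
(* tuple exists and is unique and the default value of [xget] is not used.      *)
Definition principal_curvatures (R : realType) (n : nat) (f : 'rV[R]_n -> R)
    (N : 'rV[R]_(n + 1) -> 'rV[R]_(n + 1)) (p : 'rV[R]_(n + 1)) : n.-tuple R :=
  xget [tuple 0 | i < n]
    [set k : n.-tuple R | sorted <=%R k /\
       char_poly (shape_mx f N p) = \prod_(i < n) ('X - (tnth k i)%:P)].

Definition mean_curvature (R : realType) (n : nat) (f : 'rV[R]_n -> R)
    (N : 'rV[R]_(n + 1) -> 'rV[R]_(n + 1)) (p : 'rV[R]_(n + 1)) : R :=
  let k := tnth (principal_curvatures f N p) in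
  n%:R^-1 * \sum_(i < n) k i.

Definition scalar_curvature (R : realType) (n : nat) (f : 'rV[R]_n -> R)
    (N : 'rV[R]_(n + 1) -> 'rV[R]_(n + 1)) (p : 'rV[R]_(n + 1)) : R :=
  let k := tnth (principal_curvatures f N p) in
  2 / (n%:R * (n%:R - 1)) * \sum_(i < n) \sum_(j < n | (i < j)%N) k i * k j.

(* Main.v *)
(* Let [u] be the horizontal part of the unit normal, seen as a C^1 vector    *)
(* field on R^n with |u| <= 1. In graph coordinates the shape operator is     *)
(* [- Du], so that n H = - div u is bounded and                               *)
(*   n (n - 1) R = (div u)^2 - tr (Du)^2                                      *)
(*     = 2 div (u div u) - \sum_(i, j) d_i d_j (u_i u_j)                      *)
(* is a sum of first and second derivatives of bounded functions. Its average *)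
(* at scale r is therefore O(1 / r). If |R| were bounded below by a positive  *)
(* constant, R would have constant sign by continuity and this average could  *)
(* not be small.                                                              *)
(*                                                                            *)
(* As [u] is only C^1, the second derivatives exist weakly. Instead of        *)
(* integrating against test functions, averages are taken over grids of mesh  *)
(* h and derivatives are replaced by difference quotients; then h tends to 0  *)
(* with r fixed, uniformly on a ball by compactness.                          *)
(*                                                                            *)
(* The spectral theorem is not needed: where the characteristic polynomial of *)
(* the shape operator does not split, the default value of [xget] gives R = 0. *)

Require Import Defs.
From mathcomp Require Import all_boot all_order all_algebra.
From mathcomp Require Import all_classical all_reals all_analysis.
From mathcomp Require Import ring lra.

Set Implicit Arguments.
Unset Strict Implicit.
Unset Printing Implicit Defensive.

Import Order.TTheory GRing.Theory Num.Theory.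
Import numFieldNormedType.Exports.

Local Open Scope classical_set_scope.
Local Open Scope ring_scope.

(** Suppose that |R| >= a > 0. Then R vanishes nowhere, so [curvatures_shape_mx] expresses H and R
    by traces of the shape matrix, and [shape_mxE] identifies this matrix with minus the Jacobian of
    the horizontal normal u. The curvature bounds become |div u| <= n C and |Q| >= n (n - 1) a,
    where Q = (div u)^2 - tr (Du)^2 has constant sign by [nonvanishing_constant_sign].
    [second_minor_not_bounded_away] refutes this: [discrete_second_minorE] writes a discrete Q as
    difference quotients of bounded functions plus an error, [bounded_in_averages_difference] makes
    the averages of these quotients O(1 / r), and [discrete_limits] removes the error as the mesh
    tends to 0. *)

(** * Curvatures as traces of powers of the shape operator *)

Lemma mxtrace_char_poly_prod (R : comNzRingType) n (A : 'M[R]_n)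
    (k : 'I_n -> R) :
  char_poly A = \prod_(i < n) ('X - (k i)%:P) -> \tr A = \sum_i k i.
Proof.
case: n A k => [|n] A k Ak; first by rewrite /mxtrace !big_ord0.
apply: oppr_inj; rewrite -char_poly_trace// Ak.
rewrite -(big_map k xpredT (fun z => 'X - z%:P)).
have := @coefPn_prod_XsubC R (map k (index_enum 'I_n.+1)).
rewrite size_map -[index_enum _]enumT size_enum_ord => -> //.
by rewrite enumT big_map.
Qed.

(* [det (X^2 - A^2) = det (X - A) * det (X + A)]. *)
Lemma char_poly_sqr (R : comNzRingType) n (A : 'M[R]_n) (k : 'I_n -> R) :
  char_poly A = \prod_(i < n) ('X - (k i)%:P) ->
  char_poly (A *m A) = \prod_(i < n) ('X - (k i ^+ 2)%:P).
Proof.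
move=> Ak.
(* Substituting ['X^2] for ['X] is injective, so it suffices to compare both polynomials at
   ['X^2]. *)
have comp_inj : injective (comp_poly ('X^2 : {poly R})).
  move=> p q /polyP pq; apply/polyP => i.
  by have := pq (i * 2)%N; rewrite !coef_comp_poly_Xn// dvdn_mull// mulnK.
have mx_comp (q : {poly R}) (B : 'M[R]_n) :
    map_mx (comp_poly q) (char_poly_mx B) = q%:M - map_mx polyC B.
  apply/matrixP => i j; rewrite !mxE comp_polyB comp_polyC.
  rewrite -mulr_natr comp_polyM comp_polyX -polyC_natr comp_polyC.
  by rewrite polyC_natr mulr_natr.
apply: comp_inj; rewrite /char_poly -det_map_mx mx_comp rmorph_prod/=.
(* The second factor is X + A, written as minus the substitution of - X in X - A, so that its
   determinant also comes from the factorization of [char_poly A]. *)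
have -> : 'X^2%:M - map_mx polyC (A *m A) =
    char_poly_mx A *m (-1 *: map_mx (comp_poly (- 'X)) (char_poly_mx A)).
  rewrite scaleN1r mx_comp /char_poly_mx map_mxM opprB.
  rewrite raddfN/= opprK mulmxDr !mulmxBl.
  by rewrite -scalar_mxM -expr2 scalar_mxC [RHS]addrC addrA subrK.
rewrite det_mulmx detZ det_map_mx -/(char_poly A) Ak rmorph_prod.
have -> : (-1) ^+ n = \prod_(i < n) (-1 : {poly R}).
  by rewrite prodr_const card_ord.
rewrite -!big_split; apply: eq_bigr => i _ /=.
rewrite !comp_polyB !comp_polyX !comp_polyC rmorphXn/=.
ring.
Qed.

Lemma sum_lt_pairs (R : comNzRingType) (n : nat) (k : 'I_n -> R) :
  (\sum_(i < n) \sum_(j < n | (i < j)%N) k i * k j) *+ 2 =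
  (\sum_i k i) ^+ 2 - \sum_i k i ^+ 2.
Proof.
rewrite expr2 big_distrlr/=.
have split3 (i : 'I_n) : \sum_j k i * k j =
    \sum_(j < n | (i < j)%N) k i * k j + \sum_(j < n | (j < i)%N) k i * k j +
    k i ^+ 2.
  rewrite (bigID (fun j : 'I_n => (i < j)%N))/= -addrA; congr (_ + _).
  rewrite (bigD1 i) ?ltnn//= addrC expr2; congr (_ + _).
  by apply: eq_bigl => j; rewrite -leqNgt andbC -ltn_neqAle.
rewrite (eq_bigr _ (fun i _ => split3 i)) !big_split/= addrK mulr2n.
congr (_ + _).
rewrite [RHS](exchange_big_dep xpredT)//=.
by apply: eq_bigr => i _; apply: eq_bigr => j _; rewrite mulrC.
Qed.

(** A nonzero R rules out the default tuple, whose entries all vanish. The k_i are then the roots of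
    the characteristic polynomial of the shape matrix, and their sum and sum of squares are the
    traces of this matrix and of its square. *)
Lemma curvatures_shape_mx (R : realType) (n : nat) (f : 'rV[R]_n -> R)
    (N : 'rV[R]_(n + 1) -> 'rV[R]_(n + 1)) p :
  scalar_curvature f N p != 0 ->
  mean_curvature f N p = n%:R^-1 * \tr (shape_mx f N p) /\
  scalar_curvature f N p = (n%:R * (n%:R - 1))^-1 *
    (\tr (shape_mx f N p) ^+ 2 - \tr (shape_mx f N p *m shape_mx f N p)).
Proof.
rewrite /scalar_curvature /mean_curvature /principal_curvatures.
set K := [set k : n.-tuple R | _].
case: (xgetP [tuple 0 | i < n] K) => [k _ [_ kE] _|_].
  rewrite (mxtrace_char_poly_prod kE).
  rewrite (mxtrace_char_poly_prod (char_poly_sqr kE)).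
  by split=> //; rewrite -sum_lt_pairs mulrnAr -mulrA mulr_natl.
rewrite big1 ?mulr0 ?eqxx// => i _.
by rewrite big1// => j _; rewrite tnth_mktuple mul0r.
Qed.

(** * Averages over grids and difference quotients *)

Section discrete_averages.
Context {R : realType} {V : normedModType R}.
Implicit Types (g : V -> R) (x v w : V) (h M rho : R) (m : nat).

Definition shift_average h m v g x : R :=
  m%:R^-1 * \sum_(k < m) g (x + (k%:R * h) *: v).

Definition difference_quotient h v g x : R := h^-1 * (g (x + h *: v) - g x).

Definition shift_averages h m (s : seq V) g : V -> R :=
  foldr (shift_average h m) g s.

Definition bounded_in rho M g := forall x, `|x| <= rho -> `|g x| <= M.

Lemma ler_norm_shift rho a x v :
  0 <= a -> `|v| <= 1 -> `|x| <= rho -> `|x + a *: v| <= rho + a.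
Proof.
move=> a0 v1 xr; apply: le_trans (ler_normD _ _) _.
by rewrite lerD// normrZ ger0_norm// ler_piMr.
Qed.

Lemma shift_averageE_difference h m v w g x :
  shift_average h m v (difference_quotient h w g) x =
  difference_quotient h w (shift_average h m v g) x.
Proof.
rewrite /shift_average /difference_quotient -mulrBr -sumrB mulrCA.
congr (_ * _).
by rewrite mulr_sumr; under eq_bigr do rewrite addrAC.
Qed.

Lemma shift_averagesE_difference h m s w g :
  shift_averages h m s (difference_quotient h w g) =
  difference_quotient h w (shift_averages h m s g).
Proof.
elim: s => //= v s ->; apply/funext => x; exact: shift_averageE_difference.
Qed.

(** The average only sees points displaced by at most m h, since [v] has norm at most 1; this
    accounts for the enlarged ball. *)
Lemma shift_average_ge h m v g c rho : (0 < m)%N -> 0 <= h -> `|v| <= 1 ->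
  (forall x, `|x| <= rho + m%:R * h -> c <= g x) ->
  forall x, `|x| <= rho -> c <= shift_average h m v g x.
Proof.
move=> m0 h0 v1 gc x xr; rewrite /shift_average ler_pdivlMl ?ltr0n//.
rewrite (_ : m%:R * c = \sum_(k < m) c); last first.
  by rewrite sumr_const card_ord mulr_natl.
apply: ler_sum => k _; apply: gc.
apply: le_trans (ler_norm_shift _ v1 xr) _; first by rewrite mulr_ge0.
by rewrite lerD2l ler_wpM2r// ler_nat ltnW.
Qed.

Lemma shift_averages_ge h m s g c rho : (0 < m)%N -> 0 <= h ->
  {in s, forall v, `|v| <= 1} ->
  (forall x, `|x| <= rho + (size s)%:R * (m%:R * h) -> c <= g x) ->
  forall x, `|x| <= rho -> c <= shift_averages h m s g x.
Proof.
move=> m0 h0; elim: s rho => [|v s IH] rho s1 gc /=.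
  by move=> x xr; apply: gc; rewrite mul0r addr0.
apply: shift_average_ge => //; first by rewrite s1 ?mem_head.
apply: IH => [w ws|x xr]; first by rewrite s1// in_cons ws orbT.
by apply: gc; rewrite /= -[(size _).+1]add1n natrD mulrDl mul1r addrA.
Qed.

Lemma shift_averageN h m v g x :
  shift_average h m v (fun x => - g x) x = - shift_average h m v g x.
Proof. by rewrite /shift_average sumrN mulrN. Qed.

Lemma shift_averagesN h m s g x :
  shift_averages h m s (fun x => - g x) x = - shift_averages h m s g x.
Proof.
elim: s x => //= v s IH x; rewrite -shift_averageN; congr shift_average.
exact/funext.
Qed.

Lemma shift_averagesD h m s g1 g2 x :
  shift_averages h m s (fun x => g1 x + g2 x) x =
  shift_averages h m s g1 x + shift_averages h m s g2 x.
Proof.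
elim: s x => //= v s IH x; rewrite (funext IH) /shift_average.
by rewrite big_split mulrDr.
Qed.

Lemma shift_averages_sum h m s n (g : 'I_n -> V -> R) x :
  shift_averages h m s (fun x => \sum_i g i x) x =
  \sum_i shift_averages h m s (g i) x.
Proof.
elim: s x => //= v s IH x; rewrite (funext IH) /shift_average.
by rewrite exchange_big mulr_sumr.
Qed.

Lemma bounded_in_shift_averages h m s g M rho : (0 < m)%N -> 0 <= h ->
  {in s, forall v, `|v| <= 1} ->
  bounded_in (rho + (size s)%:R * (m%:R * h)) M g ->
  bounded_in rho M (shift_averages h m s g).
Proof.
move=> m0 h0 s1 gM x xr; rewrite ler_norml; apply/andP; split.
  apply: (shift_averages_ge (rho := rho)) => // y /gM.
  by rewrite ler_norml => /andP[].
rewrite -[leLHS]opprK -shift_averagesN lerNl.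
apply: (shift_averages_ge (rho := rho)) => // y /gM.
by rewrite lerN2 ler_norml => /andP[].
Qed.

(** The sum of the quotients telescopes, leaving one quotient over the long step m h. *)
Lemma shift_average_difference h m v g x : h != 0 ->
  shift_average h m v (difference_quotient h v g) x =
  (m%:R * h)^-1 * (g (x + (m%:R * h) *: v) - g x).
Proof.
move=> h0; rewrite /shift_average /difference_quotient -mulr_sumr mulrA -invfM.
congr (_ * _); elim: m => [|m IH].
  by rewrite big_ord0 mul0r scale0r addr0 subrr.
rewrite big_ord_recr/= IH (_ : _ + h *: v = x + (m.+1%:R * h) *: v).
  by rewrite addrC subrKA.
by rewrite -addrA -scalerDl -natr1 mulrDl mul1r.
Qed.

(* Averaging over [m] steps of length [h] in the direction [v] integrates the *)
(* difference quotient in that direction.                                     *)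
Lemma bounded_in_averages_difference h m s v g M rho :
  (0 < m)%N -> 0 < h -> {in s, forall v, `|v| <= 1} -> v \in s ->
  bounded_in (rho + (size s)%:R * (m%:R * h)) M g ->
  bounded_in rho (2 * M / (m%:R * h))
    (shift_averages h m s (difference_quotient h v g)).
Proof.
move=> m0 h0; have mh0 : 0 < m%:R * h by rewrite mulr_gt0// ltr0n.
elim: s rho => //= w s IH rho s1 vs gM.
have s1' : {in s, forall v, `|v| <= 1}.
  by move=> z zs; rewrite s1// in_cons zs orbT.
have rhoE : rho + (size s).+1%:R * (m%:R * h) =
    rho + m%:R * h + (size s)%:R * (m%:R * h).
  by rewrite -[(size _).+1]add1n natrD mulrDl mul1r addrA.
(* If [v] is the outermost direction, the inner averages commute with the quotient and the outer one
   telescopes. Otherwise the induction hypothesis applies inside, and the outer average preserves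
   the bound. *)
move: vs; rewrite in_cons => /predU1P[->|vs].
  rewrite shift_averagesE_difference => x xr.
  rewrite shift_average_difference ?gt_eqF//.
  rewrite normrM gtr0_norm ?invr_gt0// [leLHS]mulrC.
  rewrite ler_wpM2r ?invr_ge0 ?(ltW mh0)//.
  have TM : bounded_in (rho + m%:R * h) M (shift_averages h m s g).
    by apply: bounded_in_shift_averages => //; [exact: ltW|rewrite -rhoE].
  apply: le_trans (ler_normB _ _) _.
  rewrite [leRHS]mulr_natl mulr2n lerD// TM//.
    by apply: ler_norm_shift => //; [exact: ltW|rewrite s1 ?mem_head].
  by apply: le_trans xr _; rewrite lerDl ltW.
have := @bounded_in_shift_averages h m [:: w]
  (shift_averages h m s (difference_quotient h v g)) (2 * M / (m%:R * h))
  rho m0.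
apply; first exact: ltW.
  by move=> z; rewrite inE => /eqP ->; rewrite s1 ?mem_head.
by rewrite mul1r; apply: IH => //; rewrite -rhoE.
Qed.

End discrete_averages.

(** * A discrete divergence identity for the second minors *)

Section discrete_second_minor.
Context {R : realType} {V : normedModType R} {n : nat}.
Variables (e : 'I_n -> V) (u : 'I_n -> V -> R) (h : R) (m : nat).
Hypotheses (e1 : forall i, `|e i| <= 1) (h0 : 0 < h) (m0 : (0 < m)%N).

Let D i j := difference_quotient h (e i) (u j).
Let s := [seq e i | i <- enum 'I_n].
(** Every direction occurs twice because a second difference, possibly with equal directions, uses
    up one average for each difference. [radius] is the total displacement. *)
Let average := @shift_averages R V h m (s ++ s).
Let radius := (n + n)%:R * (m%:R * h).

(** Discrete counterpart of (div u)^2 - tr (Du)^2. *)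
Definition discrete_second_minor x :=
  \sum_i \sum_j (D i i x * D j j x - D i j x * D j i x).

(** What the shifts in the discrete product rule leave over; it tends to 0 with h by continuity of
    Du. *)
Definition discrete_second_minor_error x :=
  \sum_i \sum_j (D i i x - D j i x) * (D j j (x + h *: e i) - D j j x).

Let s1 : {in s, forall v, `|v| <= 1}.
Proof. by move=> v /mapP[i _ ->]. Qed.

Let ss1 : {in s ++ s, forall v, `|v| <= 1}.
Proof. by move=> v; rewrite mem_cat orbb; exact: s1. Qed.

Let mem_s i : e i \in s.
Proof. by apply: map_f; rewrite mem_enum. Qed.

Let size_s : size s = n.
Proof. by rewrite size_map size_enum_ord. Qed.

(* Discrete form of                                                           *)
(* [2 S_2 = div (u div u) + d_j (u_j div u) - d_i d_j (u_i u_j)].             *)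
Lemma discrete_second_minorE x :
  discrete_second_minor x =
  \sum_i difference_quotient h (e i) (fun y => u i y * \sum_j D j j y) x +
  (\sum_j difference_quotient h (e j)
     (fun y => \sum_i D i i y * u j (y + h *: e i)) x +
  (- (\sum_i \sum_j difference_quotient h (e j)
     (difference_quotient h (e i) (fun y => u i y * u j y)) x) +
   - discrete_second_minor_error x)).
Proof.
have -> : \sum_i difference_quotient h (e i) (fun y => u i y * \sum_j D j j y) x
    = \sum_i \sum_j difference_quotient h (e i) (fun y => u i y * D j j y) x.
  apply: eq_bigr => i _; rewrite /difference_quotient.
  by rewrite !mulr_sumr -sumrB mulr_sumr.
have -> : \sum_j difference_quotient h (e j)
     (fun y => \sum_i D i i y * u j (y + h *: e i)) x =
    \sum_i \sum_j difference_quotient h (e j)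
     (fun y => D i i y * u j (y + h *: e i)) x.
  rewrite exchange_big; apply: eq_bigr => i _ /=.
  by rewrite /difference_quotient -sumrB mulr_sumr.
rewrite /discrete_second_minor /discrete_second_minor_error.
rewrite -!sumrN -!big_split; apply: eq_bigr => i _ /=.
rewrite -!sumrN -!big_split; apply: eq_bigr => j _ /=.
(* Once the two orders of the double shift are identified, second differences commute and an
   algebraic identity between values of u remains. *)
rewrite /D /difference_quotient (addrAC x (h *: e j)).
have hN0 : h != 0 by rewrite gt_eqF.
move: (u _ _) (u _ _) => *.
by field.
Qed.

Let average_difference v M g : v \in s -> bounded_in radius M g ->
  `|average (difference_quotient h v g) 0| <= 2 * M / (m%:R * h).
Proof.
move=> vs gM; apply: (bounded_in_averages_difference (rho := 0)) => //.
- by rewrite mem_cat vs.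
- by rewrite add0r size_cat size_s.
- by rewrite normr0.
Qed.

Let average_difference2 v w M g : v \in s -> w \in s -> bounded_in radius M g ->
  `|average (difference_quotient h w (difference_quotient h v g)) 0| <=
  4 * M / (m%:R * h) ^+ 2.
Proof.
move=> vs ws gM; rewrite /average /shift_averages foldr_cat.
rewrite -!/(shift_averages _ _ _ _) shift_averagesE_difference.
rewrite (_ : 4 * M / _ = 2 * (2 * M / (m%:R * h)) / (m%:R * h)); last first.
  by rewrite expr2 invfM; ring.
apply: (bounded_in_averages_difference (rho := 0)) => //; last by rewrite normr0.
apply: (bounded_in_averages_difference) => //.
by rewrite size_s add0r -mulrDl -natrD.
Qed.

(** Each first order sum has n quotients of functions bounded by B, and the second order sum has n^2
    quotients of products u_i u_j bounded by 1. The error is averaged without gain. *)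
Lemma average_discrete_second_minor B eps :
  (forall j, bounded_in radius 1 (u j)) ->
  bounded_in radius B (fun x => \sum_j D j j x) ->
  (forall j,
    bounded_in radius B (fun x => \sum_i D i i x * u j (x + h *: e i))) ->
  bounded_in radius eps discrete_second_minor_error ->
  `|average discrete_second_minor 0| <=
  n%:R * (2 * B / (m%:R * h)) + (n%:R * (2 * B / (m%:R * h)) +
  (n%:R * (n%:R * (4 * 1 / (m%:R * h) ^+ 2)) + eps)).
Proof.
move=> u1 divB drB errB.
rewrite (funext discrete_second_minorE) /average !shift_averagesD.
rewrite !shift_averagesN.
have sum_le (F : 'I_n -> R) M : (forall i, `|F i| <= M) ->
    `|\sum_i F i| <= n%:R * M.
  move=> FM; apply: le_trans (ler_norm_sum _ _ _) _.
  apply: le_trans (ler_sum _ (fun i _ => FM i)) _.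
  by rewrite sumr_const card_ord mulr_natl.
apply: le_trans (ler_normD _ _) _; apply: lerD.
  rewrite shift_averages_sum; apply: (@sum_le) => i.
  apply: average_difference => // x xr.
  rewrite normrM -[leRHS]mul1r ler_pM//; first exact: u1.
  exact: divB.
apply: le_trans (ler_normD _ _) _; apply: lerD.
  rewrite shift_averages_sum; apply: (@sum_le) => i.
  exact: average_difference.
apply: le_trans (ler_normD _ _) _; rewrite !normrN; apply: lerD.
  rewrite shift_averages_sum; apply: (@sum_le) => i.
  rewrite shift_averages_sum; apply: (@sum_le) => j.
  apply: average_difference2 => // x xr.
  by rewrite normrM -[leRHS]mul1r ler_pM//; exact: u1.
apply: (bounded_in_shift_averages (rho := 0)) => //; rewrite ?normr0//.
  exact: ltW.
by rewrite add0r size_cat size_s.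
Qed.

Lemma discrete_second_minor_estimate c B eps :
  (forall j, bounded_in radius 1 (u j)) ->
  bounded_in radius B (fun x => \sum_j D j j x) ->
  (forall j,
    bounded_in radius B (fun x => \sum_i D i i x * u j (x + h *: e i))) ->
  bounded_in radius eps discrete_second_minor_error ->
  (forall x, `|x| <= radius -> c <= discrete_second_minor x) \/
  (forall x, `|x| <= radius -> discrete_second_minor x <= - c) ->
  c <= n%:R * (2 * B / (m%:R * h)) + (n%:R * (2 * B / (m%:R * h)) +
  (n%:R * (n%:R * (4 * 1 / (m%:R * h) ^+ 2)) + eps)).
Proof.
move=> u1 divB drB errB Qc.
apply: le_trans (average_discrete_second_minor u1 divB drB errB).
have radiusE : 0 + (size (s ++ s))%:R * (m%:R * h) = radius.
  by rewrite add0r size_cat size_s.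
case: Qc => Qc.
  apply: le_trans (ler_norm _).
  apply: (shift_averages_ge (rho := 0)) => //; rewrite ?radiusE ?normr0//.
  exact: ltW.
rewrite -normrN; apply: le_trans (ler_norm _); rewrite -shift_averagesN.
apply: (shift_averages_ge (rho := 0)) => //; rewrite ?radiusE ?normr0//.
- exact: ltW.
- by move=> x /Qc; rewrite lerNr.
Qed.

End discrete_second_minor.

(** * Passage to the limit in the mesh, uniformly on a ball *)

Section difference_quotient_limit.
Context {R : realType} {V : normedModType R}.

Lemma is_derive_line (g : V -> R) (y v : V) (s : R) :
  derivable g (y + s *: v) v ->
  is_derive s 1 (fun t => g (y + t *: v)) ('D_v g (y + s *: v)).
Proof.
have quotE :
    (fun h : R => h^-1 *: (g (h *: v + (y + s *: v)) - g (y + s *: v))) =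
    fun h => h^-1 *: (g (y + (h *: 1 + s) *: v) - g (y + s *: v)).
  apply/funext => h; congr (_ *: (g _ - _)).
  by rewrite [h *: 1]mulr1 scalerDl addrCA.
move=> gyv; split.
  by rewrite /derivable/= -quotE.
by rewrite /derive/= -quotE.
Qed.

(** By the mean value theorem the quotient is a value of ['D_v g] between [y t] and
    [y t + h t *: v], and both points tend to x. *)
Lemma cvg_difference_quotient (g : V -> R) (v x : V) (T : Type)
    (F : set_system T) {FF : Filter F} (y : T -> V) (h : T -> R) :
  (forall z, derivable g z v) -> {for x, continuous ('D_v g)} ->
  y @ F --> x -> h @ F --> (0 : R) -> (\forall t \near F, 0 < h t) ->
  difference_quotient (h t) v (g) (y t) @[t --> F] --> 'D_v g x.
Proof.
move=> dg cg yx h0 hpos; apply/cvgrPdist_le => eps eps0.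
have /cvgrPdist_le/(_ _ eps0)/nbhs_ballP[d /= d0 dD] := cg.
near=> t.
have ht : 0 < h t by near: t.
have [s sh gs] : exists2 s, s \in `]0, h t[%R &
    g (y t + h t *: v) - g (y t + 0 *: v) =
    'D_v g (y t + s *: v) * (h t - 0).
  apply: (@MVT _ (fun s => g (y t + s *: v))
           (fun s => 'D_v g (y t + s *: v))) => //.
    by move=> z _; apply: is_derive_line.
  apply: continuous_subspaceT => z.
  apply/differentiable_continuous/derivable1_diffP.
  exact: (ex_derive (is_derive := is_derive_line (dg _))).
rewrite /difference_quotient.
move: gs; rewrite scale0r addr0 subr0 => ->.
rewrite mulrC mulfK ?gt_eqF//; apply: dD.
rewrite -ball_normE /ball_/= opprD addrA.
have yt : `|x - y t| < d / 2.
  by near: t; apply: cvgr_dist_lt => //; rewrite divr_gt0.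
have hv : h t * `|v| < d / 2.
  have : `|0 - h t * `|v| | < d / 2.
    near: t; apply: cvgr_dist_lt; last by rewrite divr_gt0.
    rewrite -[X in _ --> X](mul0r `|v|).
    by apply: cvgM => //; exact: cvg_cst.
  by rewrite sub0r normrN normrM normr_id gtr0_norm.
apply: le_lt_trans (ler_normB _ _) _; rewrite (splitr d) ltrD//.
apply: le_lt_trans hv; rewrite normrZ ler_wpM2r//.
by move: sh; rewrite in_itv/= => /andP[s0 sh]; rewrite gtr0_norm// ltW.
Unshelve. all: by end_near. Qed.

End difference_quotient_limit.

Lemma cvgr_sum (R : numFieldType) (n : nat) (T : Type) (F : set_system T)
    {FF : Filter F} (f : 'I_n -> T -> R) (l : 'I_n -> R) :
  (forall i, f i t @[t --> F] --> l i) ->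
  \sum_i f i t @[t --> F] --> \sum_i l i.
Proof. by move=> fl; apply: cvg_big => //; exact: add_continuous. Qed.

Lemma compact_norm_le (R : realType) (d : nat) (rho : R) :
  compact [set x : 'rV[R]_d | `|x| <= rho].
Proof.
apply: bounded_closed_compact.
  exists rho; split; first exact: num_real.
  by move=> M rM x /= xr; apply: le_trans xr (ltW rM).
rewrite (_ : [set _ | _] = (fun x : 'rV[R]_d => `|x|) @^-1` [set y | y <= rho])//.
apply: preimage_closed; last exact: closed_le.
by move=> x _; exact: norm_continuous.
Qed.

Section second_minor_bound.
Context {R : realType} {d n : nat}.
Variables (e : 'I_n -> 'rV[R]_d) (u : 'I_n -> 'rV[R]_d -> R) (B c : R).
Hypotheses (e1 : forall i, `|e i| <= 1) (u1 : forall j x, `|u j x| <= 1).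
Hypotheses (du : forall i j x, derivable (u j) x (e i)).
Hypotheses (cu : forall j, continuous (u j)).
Hypotheses (cdu : forall i j, continuous ('D_(e i) (u j))).
Hypotheses (divB : forall x, `|\sum_j 'D_(e j) (u j) x| <= B) (c0 : 0 < c).

Let Q x := \sum_i \sum_j ('D_(e i) (u i) x * 'D_(e j) (u j) x -
                          'D_(e i) (u j) x * 'D_(e j) (u i) x).

(** The filter is arbitrary so that the base point may move together with the mesh, as the
    compactness argument requires. In the error, each second factor is a difference of two
    quantities with the same limit. *)
Lemma discrete_limits (x : 'rV[R]_d) (T : Type) (F : set_system T)
    {FF : Filter F} (y : T -> 'rV[R]_d) (h : T -> R) :
  y @ F --> x -> h @ F --> (0 : R) -> (\forall t \near F, 0 < h t) ->
  let D i j t := difference_quotient (h t) (e i) (u j) (y t) in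
  [/\ \sum_j D j j t @[t --> F] --> \sum_j 'D_(e j) (u j) x,
      forall j, \sum_i D i i t * u j (y t + h t *: e i) @[t --> F] -->
                (\sum_i 'D_(e i) (u i) x) * u j x,
      discrete_second_minor_error e u (h t) (y t) @[t --> F] --> (0 : R) &
      discrete_second_minor e u (h t) (y t) @[t --> F] --> Q x].
Proof.
move=> yx h0 hpos D.
have yhx i : y t + h t *: e i @[t --> F] --> x.
  rewrite -[x in X in _ --> X]addr0 -(scale0r (e i)).
  by apply: cvgD => //; apply: cvgZ => //; exact: cvg_cst.
have cD i j : D i j t @[t --> F] --> 'D_(e i) (u j) x.
  apply: cvg_difference_quotient => //; exact: cdu.
have cDh i j k : difference_quotient (h t) (e i) (u j) (y t + h t *: e k)
    @[t --> F] --> 'D_(e i) (u j) x.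
  apply: cvg_difference_quotient => //; exact: cdu.
split.
- by apply: cvgr_sum.
- move=> j; rewrite mulr_suml; apply: cvgr_sum => i; apply: cvgM => //.
  exact: (cvg_comp _ _ (yhx i) (@cu j x)).
- rewrite (_ : 0 = \sum_i \sum_j ('D_(e i) (u i) x - 'D_(e j) (u i) x) *
    ('D_(e j) (u j) x - 'D_(e j) (u j) x)); last first.
    by rewrite big1// => i _; rewrite big1// => j _; rewrite subrr mulr0.
  apply: cvgr_sum => i; apply: cvgr_sum => j.
  apply: cvgM; apply: cvgB; (exact: cD || exact: cDh).
- apply: cvgr_sum => i; apply: cvgr_sum => j.
  by apply: cvgB; apply: cvgM; exact: cD.
Qed.

Lemma second_minor_not_bounded_away :
  ~ ((forall x, c <= Q x) \/ (forall x, Q x <= - c)).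
Proof.
move=> Qc.
have B0 : 0 <= B by apply: le_trans (divB 0).
(* S / r dominates the three boundary terms, as 1 / r^2 <= 1 / r for r >= 1, and r is chosen so that
   S / r <= c / 8. *)
pose S := 4 * n%:R * (B + 1) + 4 * n%:R ^+ 2.
have S0 : 0 <= S by rewrite addr_ge0// !mulr_ge0// addr_ge0.
pose r := 1 + 8 * S / c.
have r1 : 1 <= r by rewrite lerDl divr_ge0 ?mulr_ge0// ltW.
have r0 : 0 < r by apply: lt_le_trans r1.
(* With k + 1 steps of length [h k], the averaging length is r for every k. *)
pose h k : R := r / k.+1%:R.
have hpos k : 0 < h k by rewrite divr_gt0.
have h0 : h @ \oo --> (0 : R).
  rewrite -(mulr0 r); apply: cvgM; first exact: cvg_cst.
  exact: cvg_harmonic.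
(* The limits are met up to a margin: B + 1 for B, c / 8 for the error, c / 2 for c. Each final
   alternative records the sign of Q, so that the same one holds at all points. *)
pose P k x := [/\ `|\sum_j difference_quotient (h k) (e j) (u j) x| <= B + 1,
   (forall j, `|\sum_i difference_quotient (h k) (e i) (u i) x *
                       u j (x + h k *: e i)| <= B + 1),
   `|discrete_second_minor_error e u (h k) x| <= c / 8 &
   (forall z, c <= Q z) /\ c / 2 <= discrete_second_minor e u (h k) x \/
   (forall z, Q z <= - c) /\ discrete_second_minor e u (h k) x <= - (c / 2)].
(* Around each x, [P k] holds at all nearby points for large k; compactness gives one k for the
   whole ball. *)
have [k KP] : exists k, [set x | `|x| <= (n + n)%:R * r] `<=` P k.
  suff /filter_ex[k kP] :
      \forall k \near \oo, [set x | `|x| <= (n + n)%:R * r] `<=` P k.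
    by exists k.
  have /compact_near_coveringP := @compact_norm_le R d ((n + n)%:R * r).
  apply => x _.
  pose F := filter_prod (nbhs x) (nbhs (\oo : set_system nat)).
  have [cdiv cdr cerr cQ] := @discrete_limits x _ F _ fst (h \o snd) cvg_fst
    (cvg_comp _ _ cvg_snd h0) (nearW _ (fun t => hpos t.2)).
  have Qnear : \forall t \near F,
      (forall z, c <= Q z) /\ c / 2 <= discrete_second_minor e u (h t.2) t.1 \/
      (forall z, Q z <= - c) /\
      discrete_second_minor e u (h t.2) t.1 <= - (c / 2).
    have c2 : c / 2 < c by rewrite gtr_pMr// invf_lt1 ?ltr1n.
    case: Qc => Qc.
      have := cvgr_ge _ cQ _ (lt_le_trans c2 (Qc x)).
      by move=> Qn; near=> t; left; split; [exact: Qc|near: t; exact: Qn].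
    have Qc2 : Q x < - (c / 2) by apply: le_lt_trans (Qc x) _; rewrite ltrN2.
    have := cvgr_le _ cQ _ Qc2.
    by move=> Qn; near=> t; right; split; [exact: Qc|near: t; exact: Qn].
  near=> t; split.
  - near: t; apply: (cvgr_norm_le _ cdiv).
    by apply: le_lt_trans (divB x) _; rewrite ltrDl.
  - near: t; apply: filter_forall => j.
    apply: (cvgr_norm_le _ (cdr j)); rewrite normrM.
    apply: le_lt_trans (_ : B < _); last by rewrite ltrDl.
    by rewrite -[leRHS]mulr1 ler_pM.
  - near: t; apply: (cvgr_norm_le _ cerr).
    by rewrite normr0 divr_gt0.
  - by near: t.
have Pk x : `|x| <= (n + n)%:R * r -> P k x by exact: KP.
have khr : k.+1%:R * h k = r by rewrite /h mulrC divfK.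
have : c / 2 <= n%:R * (2 * (B + 1) / r) + (n%:R * (2 * (B + 1) / r) +
    (n%:R * (n%:R * (4 * 1 / r ^+ 2)) + c / 8)).
  rewrite -khr; apply: (@discrete_second_minor_estimate _ _ _ e u) => //.
  - by move=> j x _; exact: u1.
  - by rewrite khr => x /Pk[].
  - by rewrite khr => j x /Pk[].
  - by rewrite khr => x /Pk[].
  - rewrite khr; case: Qc => Qc; [left|right] => x /Pk[_ _ _ []] [] // Qc'.
      by have := le_trans (Qc 0) (Qc' 0); rewrite leNgt gtrN.
    by have := le_trans (Qc' 0) (Qc 0); rewrite leNgt gtrN.
(* The estimate now reads c / 2 <= c / 8 + c / 8, which is absurd. *)
have Sr : S / r <= c / 8.
  have cS : c / 8 * (8 * S / c) = S by field; rewrite gt_eqF.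
  rewrite ler_pdivrMr// /r mulrDr mulr1 cS.
  by rewrite lerDr divr_ge0 ?ltW.
have r2 : 4 * 1 / r ^+ 2 <= 4 / r.
  by rewrite mulr1 ler_pM2l// lef_pV2 ?posrE ?exprn_gt0// ler_eXnr.
have n2 : n%:R * (n%:R * (4 * 1 / r ^+ 2)) <= n%:R * (n%:R * (4 / r)).
  by rewrite !ler_wpM2l.
have SE : S / r = n%:R * (2 * (B + 1) / r) + (n%:R * (2 * (B + 1) / r)) +
    n%:R * (n%:R * (4 / r)) by rewrite /S; ring.
move: Sr n2; rewrite SE.
move: (n%:R * (2 * _ / r)) (n%:R * (n%:R * (4 / r))) => a1 a2.
move: (n%:R * _) => a3 Sr a32 bound; have c_gt0 := c0; lra.
Unshelve. all: by end_near. Qed.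

End second_minor_bound.

(** * Functions of class C^1 and functions without zeros *)

Section C1_closure.
Context {R : realType} {n : nat}.
Implicit Types f g : 'rV[R]_n -> R.

Lemma is_C1_continuous f : is_C1 f -> continuous f.
Proof. by move=> [df _] x; apply: differentiable_continuous. Qed.

Lemma is_C1_cst (c : R) : is_C1 (cst c : 'rV[R]_n -> R).
Proof.
split=> [x|v]; first exact: differentiable_cst.
rewrite (_ : 'D_v _ = cst 0); first exact: cst_continuous.
by apply/funext => x; exact: derive_cst.
Qed.

Lemma is_C1D f g : is_C1 f -> is_C1 g -> is_C1 (f + g).
Proof.
move=> [df cf] [dg cg]; split=> [x|v]; first exact: differentiableD.
rewrite (_ : 'D_v _ = 'D_v f + 'D_v g).
  by move=> x; apply: continuousD; [exact: cf|exact: cg].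
by apply/funext => x; apply: deriveD; exact: diff_derivable.
Qed.

Lemma is_C1M f g : is_C1 f -> is_C1 g -> is_C1 (f * g).
Proof.
move=> Cf Cg; have [[df cf] [dg cg]] := (Cf, Cg).
split=> [x|v]; first exact: differentiableM.
rewrite (_ : 'D_v _ = f * 'D_v g + g * 'D_v f).
  move=> x; have fx := is_C1_continuous Cf (x := x).
  have gx := is_C1_continuous Cg (x := x).
  apply: continuousD; apply: continuousM.
  - exact: fx.
  - exact: cg.
  - exact: gx.
  - exact: cf.
by apply/funext => x; apply: deriveM; exact: diff_derivable.
Qed.

Lemma is_C1_sum m (f : 'I_m -> 'rV[R]_n -> R) :
  (forall i, is_C1 (f i)) -> is_C1 (\sum_i f i).
Proof.
move=> Cf; elim/big_ind : _ => //; [exact: is_C1_cst|exact: is_C1D].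
Qed.

Lemma is_C1V f : (forall x, f x != 0) -> is_C1 f -> is_C1 (fun x => (f x)^-1).
Proof.
move=> f0 Cf; have [df cf] := Cf.
split=> [x|v]; first exact: differentiableV.
pose g x := (f x)^-1.
have cg : continuous g.
  by move=> x; exact: (cvgV (f0 x) (is_C1_continuous Cf (x := x))).
rewrite (_ : 'D_v _ = - (g * g) * 'D_v f).
  move=> x; apply: continuousM; last exact: cf.
  by apply: continuousN; apply: continuousM; exact: cg.
apply/funext => x; rewrite deriveV//; last exact: diff_derivable.
by rewrite expr2 invfM.
Qed.

Lemma is_C1_sqrt f : (forall x, 0 < f x) -> is_C1 f ->
  is_C1 (fun x => Num.sqrt (f x)).
Proof.
move=> f0 Cf; have [df cf] := Cf.
have ds x : differentiable (fun x => Num.sqrt (f x)) x.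
  apply: (differentiable_comp (df x)).
  apply/derivable1_diffP.
  exact: (ex_derive (is_derive := is_derive1_sqrt (f0 x))).
have s0 x : Num.sqrt (f x) != 0 by rewrite gt_eqF// sqrtr_gt0.
split=> [//|v].
pose g x := (2 * Num.sqrt (f x))^-1.
have cg : continuous g.
  move=> x; have s2 : 2 * Num.sqrt (f x) != 0 by rewrite mulf_neq0.
  exact: (cvgV s2 (cvgM (cvg_cst _) (differentiable_continuous (ds x)))).
rewrite (_ : 'D_v _ = g * 'D_v f).
  by move=> x; apply: continuousM; [exact: cg|exact: cf].
apply/funext => x.
(* The chain rule gave differentiability; the value of the derivative comes from differentiating
   this square. *)
have fE : f = (fun x => Num.sqrt (f x)) * (fun x => Num.sqrt (f x)).
  by apply/funext => y; rewrite fctE -expr2 sqr_sqrtr// ltW.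
have dsv : derivable (fun x => Num.sqrt (f x)) x v by exact: diff_derivable.
have := congr1 (fun h => 'D_v h x) fE; rewrite deriveM// -mulr2n => fD.
rewrite -[RHS]/(g x * 'D_v f x) fD /g -[_ *: _]/(Num.sqrt (f x) * _).
by field; exact: s0.
Qed.

(** The intermediate value theorem on the segment from 0 to x forbids a change of sign. *)
Lemma nonvanishing_constant_sign f : continuous f -> (forall x, f x != 0) ->
  (forall x, 0 < f x) \/ (forall x, f x < 0).
Proof.
move=> cf f0.
have path x : 0 < f x * f 0.
  pose g t := f (t *: x) * f 0.
  have cg : continuous g.
    move=> t; apply: continuousM; last exact: cst_continuous.
    apply: continuous_comp; last exact: cf.
    by apply: continuousZl; exact: cvg_id.
  have g0 : 0 < g 0 by rewrite /g scale0r -expr2 exprn_even_gt0//= f0.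
  rewrite ltNge; apply/negP => fx.
  have [t _ gt] : exists2 t, t \in `[0, 1]%R & g t = 0.
    apply: IVT => //; first exact: continuous_subspaceT.
    have g1 : g 1 <= 0 by rewrite /g scale1r.
    by rewrite ge_min le_max g1 (ltW g0) orbT.
  by have := mulf_neq0 (f0 (t *: x)) (f0 0); rewrite -/(g t) gt eqxx.
have [f00|f00] := ltP 0 (f 0); [left|right] => x.
  by have := path x; rewrite pmulr_lgt0.
by have := path x; rewrite nmulr_lgt0// lt_neqAle f0.
Qed.

End C1_closure.

(** * Jacobians and the parametrization of the graph *)

Lemma differentiable_rV (R : realType) (V : normedModType R) (m : nat)
    (F : V -> 'rV[R]_m) (x : V) :
  (forall j, differentiable (fun y => F y 0 j) x) -> differentiable F x.
Proof.
move=> dF.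
rewrite (_ : F = \sum_j (fun y => F y 0 j *: (delta_mx 0 j : 'rV[R]_m))).
  by apply: differentiable_sum => j; apply: differentiableZl.
by apply/funext => y; rewrite [LHS]row_sum_delta fct_sumE.
Qed.

Lemma jacobianE (R : realType) (n m : nat) (F : 'rV[R]_n -> 'rV[R]_m) x i j :
  differentiable F x ->
  'J F x i j = 'D_(delta_mx 0 i) (fun y => F y 0 j) x.
Proof.
move=> dF.
have := deriveEjacobian (delta_mx 0 i) dF.
rewrite derive_mx; last exact: diff_derivable.
by move=> /rowP/(_ j); rewrite -rowE !mxE.
Qed.

Lemma norm_delta_mx_le1 (R : realType) (n : nat) (i : 'I_n) :
  `|delta_mx 0 i : 'rV[R]_n| <= 1.
Proof.
rewrite [leLHS]/Num.Def.normr/= mx_normrE; apply: bigmax_le => // ij _.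
by rewrite mxE; case: (_ && _); rewrite ?normr1 ?normr0.
Qed.

Lemma graph_param_lsubmx (R : realType) (n : nat) (f : 'rV[R]_n -> R) x :
  lsubmx (graph_param f x) = x.
Proof. by rewrite /graph_param row_mxKl. Qed.

Lemma graph_param_lshift (R : realType) (n : nat) (f : 'rV[R]_n -> R) x j :
  graph_param f x 0 (lshift 1 j) = x 0 j.
Proof. by rewrite /graph_param row_mxEl. Qed.

Lemma graph_param_rshift (R : realType) (n : nat) (f : 'rV[R]_n -> R) x j :
  graph_param f x 0 (rshift n j) = f x.
Proof. by rewrite /graph_param row_mxEr mxE ord1. Qed.

Lemma differentiable_graph_param (R : realType) (n : nat) (f : 'rV[R]_n -> R)
    x :
  differentiable f x -> differentiable (graph_param f) x.
Proof.
move=> dfx; apply: differentiable_rV => j; case: (split_ordP j) => k ->.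
  rewrite (_ : (fun _ => _) = fun y : 'rV[R]_n => y 0 k).
    exact: differentiable_coord.
  by apply/funext => y; rewrite graph_param_lshift.
rewrite (_ : (fun _ => _) = f)//.
by apply/funext => y; rewrite graph_param_rshift.
Qed.

Lemma tangent_basisE (R : realType) (n : nat) (f : 'rV[R]_n -> R) x :
  differentiable f x ->
  tangent_basis f (graph_param f x) =
  row_mx 1%:M (\col_i 'D_(delta_mx 0 i) f x).
Proof.
move=> dfx; rewrite /tangent_basis graph_param_lsubmx.
apply/matrixP => i j; rewrite jacobianE; last exact: differentiable_graph_param.
case: (split_ordP j) => k ->.
  rewrite row_mxEl mxE; under eq_fun do rewrite graph_param_lshift.
  have := @derive_mx R _ 1 n id x (delta_mx 0 i)
    (@derivable_id _ _ _ _).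
  rewrite derive_id => /rowP/(_ k); rewrite !mxE => <-.
  by rewrite eqxx eq_sym.
by rewrite row_mxEr mxE; under eq_fun do rewrite graph_param_rshift.
Qed.

(** * The unit normal and the shape operator in graph coordinates *)

Section gauss_map.
Context {R : realType} {n : nat}.
Variables (f : 'rV[R]_n -> R) (N : 'rV[R]_(n + 1) -> 'rV[R]_(n + 1)).
Hypotheses (hf : is_C2 f) (hN : unit_normal_field f N).

Definition horizontal_normal (j : 'I_n) (x : 'rV[R]_n) : R :=
  N (graph_param f x) 0 (lshift 1 j).

Definition vertical_normal (x : 'rV[R]_n) : R :=
  N (graph_param f x) 0 (rshift n 0).

Let u := horizontal_normal.
Let w := vertical_normal.
Let e (i : 'I_n) : 'rV[R]_n := delta_mx 0 i.

Let df x : differentiable f x. Proof. by case: hf => -[]. Qed.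

Let on_graph x : graph f (graph_param f x). Proof. by exists x. Qed.

Lemma normal_norm x : \sum_j u j x ^+ 2 + w x ^+ 2 = 1.
Proof.
have [/matrixP/(_ 0 0) + _] := hN.2 _ (on_graph x).
rewrite !mxE big_split_ord/= big_ord1 !mxE mulr1n => <-.
by congr (_ + _); apply: eq_bigr => j _; rewrite mxE expr2.
Qed.

(** This is orthogonality to the tangent vector (e_i, d_i f). *)
Lemma horizontal_normalE i x : u i x = - (w x * 'D_(e i) f x).
Proof.
have [_ /matrixP/(_ i 0)] := hN.2 _ (on_graph x).
rewrite tangent_basisE// !mxE big_split_ord/= big_ord1.
rewrite (bigD1 i)//= big1 => [|j ji]; last first.
  by rewrite row_mxEl mxE eq_sym (negbTE ji) mul0r.
rewrite row_mxEl row_mxEr !mxE. rewrite eqxx mul1r addr0 => /eqP.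
by rewrite addr_eq0 mulrC => /eqP.
Qed.

Lemma vertical_normal_sqr x : w x ^+ 2 * (1 + \sum_j 'D_(e j) f x ^+ 2) = 1.
Proof.
rewrite -[RHS](normal_norm x) mulrDr mulr1 addrC; congr (_ + _).
rewrite mulr_sumr; apply: eq_bigr => j _.
by rewrite horizontal_normalE sqrrN exprMn.
Qed.

Lemma vertical_normal_neq0 x : w x != 0.
Proof.
apply/eqP => wx; have := vertical_normal_sqr x.
by rewrite wx expr0n mul0r => /esym/eqP; rewrite oner_eq0.
Qed.

(** [N] is continuous only within the graph, but the parametrization takes its values there. *)
Lemma vertical_normal_continuous : continuous w.
Proof.
have /subspace_continuousP cN := hN.1.
move=> x.
have cg : graph_param f @ x --> within (graph f) (nbhs (graph_param f x)).
  move=> A AN; change (nbhs x (graph_param f @^-1` A)).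
  have gA : nbhs x (graph_param f @^-1` [set z | graph f z -> A z]).
    exact: (differentiable_continuous (differentiable_graph_param (df x)) AN).
  by apply: (filterS _ gA) => y /=; apply; exact: on_graph.
have cNg := cvg_comp _ _ cg (cN _ (on_graph x)).
exact: (cvg_comp _ _ cNg (@coord_continuous _ _ _ _ _ _)).
Qed.

(** Continuity of [N] upgrades to C^1: w has no zeros, hence constant sign, so w is one of the two
    functions +-(1 + |grad f|^2)^(-1/2) on all of R^n, and grad f is C^1. *)
Lemma is_C1_vertical_normal : is_C1 w.
Proof.
pose g : 'rV[R]_n -> R := cst 1 + \sum_j ('D_(e j) f * 'D_(e j) f).
have gE x : g x = 1 + \sum_j 'D_(e j) f x ^+ 2.
  rewrite /g fctE fct_sumE; congr (_ + _); apply: eq_bigr => j _.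
have g0 x : 0 < g x by rewrite gE ltr_pwDl// sumr_ge0// => j _; exact: sqr_ge0.
have Cg : is_C1 g.
  apply: is_C1D; first exact: is_C1_cst.
  by apply: is_C1_sum => j; apply: is_C1M; exact: hf.2.
have sg0 x : Num.sqrt (g x) != 0 by rewrite gt_eqF// sqrtr_gt0.
have Csg : is_C1 (fun x => (Num.sqrt (g x))^-1).
  exact: is_C1V sg0 (is_C1_sqrt g0 Cg).
have absw x : `|w x| = (Num.sqrt (g x))^-1.
  apply: (mulIf (sg0 x)); rewrite mulVf//.
  have := congr1 Num.sqrt (vertical_normal_sqr x).
  by rewrite -gE sqrtrM ?sqr_ge0// sqrtr_sqr sqrtr1.
have [wpos|wneg] := nonvanishing_constant_sign vertical_normal_continuous
  vertical_normal_neq0.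
  rewrite (_ : w = fun x => (Num.sqrt (g x))^-1)//.
  by apply/funext => x; rewrite -absw gtr0_norm.
rewrite (_ : w = cst (-1) * (fun x => (Num.sqrt (g x))^-1)).
  by apply: is_C1M => //; exact: is_C1_cst.
apply/funext => x.
by rewrite -[RHS]/(-1 * (Num.sqrt (g x))^-1) -absw ltr0_norm// mulN1r opprK.
Qed.

Lemma is_C1_horizontal_normal j : is_C1 (u j).
Proof.
rewrite (_ : u j = cst (-1) * w * 'D_(e j) f).
  apply: is_C1M; last exact: hf.2.
  by apply: is_C1M; [exact: is_C1_cst|exact: is_C1_vertical_normal].
by apply/funext => x; rewrite horizontal_normalE /= mulN1r mulNr.
Qed.

Lemma differentiable_normal x : differentiable (N \o graph_param f) x.
Proof.
apply: differentiable_rV => j; case: (split_ordP j) => k ->.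
  exact: (is_C1_horizontal_normal k).1.
by rewrite [k]ord1; exact: is_C1_vertical_normal.1.
Qed.

(** Differentiating |N|^2 = 1, substituting u_j = - w d_j f and cancelling w shows that d_i N is
    tangent to the graph. *)
Lemma derive_vertical_normal i x :
  'D_(e i) w x = \sum_j 'D_(e i) (u j) x * 'D_(e j) f x.
Proof.
pose g := \sum_j (u j * u j) + w * w.
have g1 : g = cst 1.
  apply/funext => y; rewrite -[RHS](normal_norm y) /g fctE fct_sumE.
  by congr (_ + _); apply: eq_bigr => j _.
have du j : derivable (u j) x (e i).
  by apply: diff_derivable; exact: (is_C1_horizontal_normal j).1.
have dw : derivable w x (e i).
  by apply: diff_derivable; exact: is_C1_vertical_normal.1.
have : 'D_(e i) g x = 0 by rewrite g1 derive_cst.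
rewrite deriveD; last 2 first.
- by apply: derivable_sum => j; exact: derivableM.
- exact: derivableM.
rewrite derive_sum; last by move=> j; exact: derivableM.
rewrite deriveM// -mulr2n -[_ *: _]/(_ * _).
rewrite (eq_bigr (fun j => - w x * ('D_(e i) (u j) x * 'D_(e j) f x) *+ 2)).
  rewrite sumrMnl -mulrnDl -mulr_sumr => /eqP.
  rewrite mulrn_eq0/= mulNr addrC subr_eq0 => /eqP.
  exact: (mulfI (vertical_normal_neq0 x)).
move=> j _; rewrite deriveM// -mulr2n -[_ *: _]/(_ * _).
by rewrite horizontal_normalE; congr (_ *+ 2); ring.
Qed.

(** The tangent vector d_i N has as coefficients on the (e_j, d_j f) its own horizontal coordinates
    d_i u_j. *)
Lemma shape_mxE x :
  shape_mx f N (graph_param f x) = - \matrix_(i, j) 'D_(e i) (u j) x.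
Proof.
rewrite /shape_mx graph_param_lsubmx.
have -> : 'J (N \o graph_param f) x =
    (\matrix_(i, j) 'D_(e i) (u j) x) *m tangent_basis f (graph_param f x).
  rewrite tangent_basisE// mul_mx_row mulmx1.
  apply/matrixP => i j; rewrite jacobianE; last exact: differentiable_normal.
  case: (split_ordP j) => k ->.
    by rewrite row_mxEl mxE.
  rewrite row_mxEr mxE [k]ord1 -[LHS]/('D_(e i) w x) derive_vertical_normal.
  by apply: eq_bigr => l _; rewrite !mxE.
rewrite -mulNmx -mulmxA mulmxVp ?mulmx1//.
(* The rows of the tangent basis are free, so [pinvmx] is a right inverse. *)
apply/row_freeP; exists (col_mx 1%:M 0).
by rewrite tangent_basisE// mul_row_col mulmx1 mulmx0 addr0.
Qed.

End gauss_map.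

Theorem corollary1p3 (R : realType) (n : nat) (hn : (2 <= n)%N)
    (f : 'rV[R]_n -> R) (hf : is_C2 f)
    (N : 'rV[R]_(n + 1) -> 'rV[R]_(n + 1)) (hN : unit_normal_field f N)
    (hH : exists C : R, forall p, graph f p -> `|mean_curvature f N p| <= C) :
  inf [set `|scalar_curvature f N p| | p in graph f] = 0 /\
  ((exists c : R, forall p, graph f p -> scalar_curvature f N p = c) ->
   forall p, graph f p -> scalar_curvature f N p = 0).
Proof.
set A := [set _ | _ in _].
have on_graph x : graph f (graph_param f x) by exists x.
have A_ge0 : lbound A 0 by move=> _ [p _ <-].
have infA : inf A = 0.
  apply/eqP; rewrite eq_le; apply/andP; split; last first.
    apply: lb_le_inf A_ge0; exists `|scalar_curvature f N (graph_param f 0)|.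
    by exists (graph_param f 0).
  rewrite leNgt; apply/negP => infA_gt0.
  have R_ge x : inf A <= `|scalar_curvature f N (graph_param f x)|.
    by apply: ge_inf; [exists 0|exists (graph_param f x)].
  have R_neq0 x : scalar_curvature f N (graph_param f x) != 0.
    by rewrite -normr_gt0; exact: lt_le_trans (R_ge x).
  pose u := horizontal_normal f N.
  pose e i : 'rV[R]_n := delta_mx 0 i.
  have Cu j : is_C1 (u j) by exact: is_C1_horizontal_normal.
  pose Q x := \sum_i \sum_j ('D_(e i) (u i) x * 'D_(e j) (u j) x -
                             'D_(e i) (u j) x * 'D_(e j) (u i) x).
  have n0 : 0 < n%:R :> R by rewrite ltr0n (leq_trans _ hn).
  have nn0 : 0 < n%:R * (n%:R - 1) :> R.
    by rewrite mulr_gt0// subr_gt0 ltr1n.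
  (* Both traces are quadratic in the shape matrix, so the sign in - Du disappears. *)
  have QE x : Q x = n%:R * (n%:R - 1) * scalar_curvature f N (graph_param f x).
    rewrite (curvatures_shape_mx (R_neq0 x)).2 mulVKf ?gt_eqF// shape_mxE//.
    rewrite mulNmx mulmxN opprK raddfN sqrrN expr2 /mxtrace big_distrlr -sumrB.
    apply: eq_bigr => i _; rewrite [(_ *m _) _ _]mxE -sumrB.
    by apply: eq_bigr => j _; rewrite !mxE.
  have [C HC] := hH.
  apply: (@second_minor_not_bounded_away R n n e u (n%:R * C)
    (n%:R * (n%:R - 1) * inf A)).
  - exact: norm_delta_mx_le1.
  (* |u_j| <= 1 because u_j^2 is one of the squares adding up to |N|^2 = 1. *)
  - move=> j x; rewrite -[leRHS]sqrtr1 -sqrtr_sqr ler_wsqrtr//.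
    rewrite -(normal_norm hN x) (bigD1 j)//= -addrA lerDl addr_ge0 ?sqr_ge0//.
    by apply: sumr_ge0 => i _; exact: sqr_ge0.
  - by move=> i j x; apply: diff_derivable; exact: (Cu j).1.
  - by move=> j; apply: is_C1_continuous; exact: Cu.
  - by move=> i j; exact: (Cu j).2.
  - move=> x; have := HC _ (on_graph x).
    rewrite (curvatures_shape_mx (R_neq0 x)).1 shape_mxE// raddfN mulrN normrN.
    rewrite normrM gtr0_norm ?invr_gt0// ler_pdivrMl//.
    rewrite /= (_ : \tr _ = \sum_j 'D_(e j) (u j) x)//.
    by apply: eq_bigr => j _; rewrite mxE.
  - by rewrite mulr_gt0.
  (* Q is continuous without zeros, so the bound on |Q| becomes a one-sided bound on Q. *)
  have cQ : continuous Q.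
    move=> x; apply: (@cvgr_sum _ _ _ (nbhs x)) => i.
    apply: (@cvgr_sum _ _ _ (nbhs x)) => j.
    by apply: cvgB; apply: cvgM; exact: (Cu _).2.
  have absQ x : n%:R * (n%:R - 1) * inf A <= `|Q x|.
    by rewrite QE normrM gtr0_norm// ler_wpM2l// ltW.
  have Q0 x : Q x != 0 by rewrite QE mulf_neq0// gt_eqF.
  have [Qpos|Qneg] := nonvanishing_constant_sign cQ Q0; [left|right] => x.
    by have := absQ x; rewrite gtr0_norm.
  by rewrite lerNr; have := absQ x; rewrite ltr0_norm.
(* For constant R = c the set of values of |R| is {|c|}, with infimum |c|. *)
split=> // -[c Rc] p gp; apply/eqP; rewrite -normr_eq0; apply/eqP.
rewrite -infA (_ : A = [set `|c|]); first by rewrite inf1 Rc.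
apply/seteqP; split=> [_ [q gq <-]|_ ->]; first by rewrite /= Rc.
by exists p => //; rewrite Rc.
Qed.
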